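(* Let $\boldsymbol{\beta}=(\beta_1,\dots,\beta_p)$ be an alternate base with Property (PP), and let $\delta=\prod_{i=1}^p\beta_i$. Then $\delta$ is a Pisot unit or a Salem unit, $\beta_i\in\mathbb{Q}(\delta)$ for every $i=1,\dots,p$, and for every non-identical field embedding $\psi:\mathbb{Q}(\delta)\to\mathbb{C}$ the vector $(\psi(\beta_1),\dots,\psi(\beta_p))$ is not positive (i.e. it is not the case that all $\psi(\beta_i)$ are positive real numbers).
   Context: An alternate base is a $p$-tuple $\boldsymbol{\beta}=(\beta_1,\dots,\beta_p)$ of real numbers $\beta_i>1$, identified with the purely periodic sequence $(\beta_k)_{k\ge1}$, $\beta_{k+p}=\beta_k$. For $x\in[0,1)$ the $\boldsymbol{\beta}$-expansion $d_{\boldsymbol{\beta}}(x)=a_1a_2\cdots$ is given by the greedy algorithm $r_0=x$, $a_{k+1}=\lfloor\beta_{k+1}r_k\rfloor$, $r_{k+1}=\beta_{k+1}r_k-a_{k+1}$, so $x=\sum_{k\ge1}a_k/\prod_{i=1}^k\beta_i$. The base $\boldsymbol{\beta}$ has Property (PP) (pure periodicity property) if there exists $\gamma>0$ such that $d_{\boldsymbol{\beta}}(x)$ is purely periodic for every $x\in[0,\gamma)\cap\mathbb{Q}$. A Pisot (resp. Salem) unit is a Pisot (resp. Salem) number that is an algebraic unit; a Pisot number is a real algebraic integer $>1$ whose other conjugates all have modulus $<1$, a Salem number is a real algebraic integer $>1$ whose other conjugates all have modulus $\le1$ with at least one of modulus $1$. *)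

(* Defs.v *)
From mathcomp Require Import all_boot all_order all_algebra.
From mathcomp Require Import complex reals.
Set Implicit Arguments. Unset Strict Implicit. Unset Printing Implicit Defensive.
Import Order.TTheory GRing.Theory Num.Theory.
Local Open Scope ring_scope.

Section AltBase.
Variable R : realType.

(* An alternate base (beta_1,...,beta_p) is given as a list bs of length p.
   The k-th base (1-indexed) is nth 0 bs ((k-1) mod p). *)
Definition alt_base (bs : seq R) : Prop :=
  (0 < size bs)%N /\ forall i, (i < size bs)%N -> 1 < nth 0 bs i.

(* k-th base, 0-indexed: base_at bs k = beta_{k+1} *)
Definition base_at (bs : seq R) (k : nat) : R := nth 0 bs (k %% size bs).

Fixpoint ab_rem (bs : seq R) (x : R) (k : nat) : R :=
  match k with
  | 0 => x
  | k'.+1 => base_at bs k' * ab_rem bs x k'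
             - (Num.floor (base_at bs k' * ab_rem bs x k'))%:~R
  end.

(* ab_digit bs x k = a_{k+1} = floor(beta_{k+1} r_k); the expansion
   d_beta(x) = a_1 a_2 ... is the sequence k |-> ab_digit bs x k. *)
Definition ab_digit (bs : seq R) (x : R) (k : nat) : int :=
  Num.floor (base_at bs k * ab_rem bs x k).

Definition purely_periodic (u : nat -> int) : Prop :=
  exists n : nat, (0 < n)%N /\ forall k, u (k + n)%N = u k.

(* Property (PP); x ranges over rationals in [0, gamma) (and in [0,1), the
   domain of d_beta) *)
Definition property_PP (bs : seq R) : Prop :=
  exists gamma : R, 0 < gamma /\
    forall q : rat, 0 <= (ratr q : R) -> (ratr q : R) < gamma -> (ratr q : R) < 1 ->
      purely_periodic (ab_digit bs (ratr q)).

Definition algebraic_integer (x : R) : Prop :=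
  exists P : {poly int}, P \is monic /\ root (map_poly intr P) x.

Definition algebraic_unit (x : R) : Prop :=
  algebraic_integer x /\ algebraic_integer x^-1.

Definition conjugate_of (x : R) (z : R[i]) : Prop :=
  exists P : {poly rat}, P \is monic /\ irreducible_poly P /\
    root (map_poly ratr P) x /\ root (map_poly ratr P) z.

Definition pisot_number (x : R) : Prop :=
  algebraic_integer x /\ 1 < x /\
  forall z : R[i], conjugate_of x z -> z != (x%:C)%C -> `|z| < 1.

Definition salem_number (x : R) : Prop :=
  algebraic_integer x /\ 1 < x /\
  (forall z : R[i], conjugate_of x z -> z != (x%:C)%C -> `|z| <= 1) /\
  (exists z : R[i], conjugate_of x z /\ z != (x%:C)%C /\ `|z| = 1).

Definition pisot_unit (x : R) : Prop := pisot_number x /\ algebraic_unit x.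
Definition salem_unit (x : R) : Prop := salem_number x /\ algebraic_unit x.

Definition in_Qadj (d y : R) : Prop :=
  exists P Q : {poly rat},
    (map_poly ratr Q).[d] != 0 /\ y = (map_poly ratr P).[d] / (map_poly ratr Q).[d].

(* psi (restricted to Q(d)) is a field embedding Q(d) -> C *)
Definition field_embedding (d : R) (psi : R -> R[i]) : Prop :=
  psi 1 = 1 /\
  (forall x y, in_Qadj d x -> in_Qadj d y -> psi (x + y) = psi x + psi y) /\
  (forall x y, in_Qadj d x -> in_Qadj d y -> psi (x * y) = psi x * psi y).

Definition non_identical (d : R) (psi : R -> R[i]) : Prop :=
  exists x, in_Qadj d x /\ psi x != (x%:C)%C.

Definition positive_real (z : R[i]) : Prop :=
  complex.Im z = 0 /\ 0 < complex.Re z.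

End AltBase.

(* Main.v *)
Require Import Defs.
From mathcomp Require Import all_boot all_order all_algebra.
From mathcomp Require Import complex reals.
From mathcomp Require Import boolp ring lra zify.
Set Implicit Arguments. Unset Strict Implicit. Unset Printing Implicit Defensive.
Import Order.TTheory GRing.Theory Num.Theory.
Local Open Scope ring_scope.

(** Write [T_j = beta_{j+1} ... beta_p]. If the digits [a] of a rational [x] are purely
    periodic, then the remainder returns to [x] after [N p] steps for some [N > 0], that is
      [x (delta^N - 1) = \sum_j T_j S_j(delta)],  [S_j = \sum_k a_{(k-1)p+j} X^(N-k)].
    - Rationals just above [1 / (beta_1 ... beta_J)] have digits [0..010..0] on a long
      prefix. One such relation per residue of [J] modulo [p] gives a diagonally dominant
      linear system for the [T_j], so the [T_j], hence the [beta_i], lie in [Q(delta)].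
    - Applying to these relations a conjugation [delta -> eta] with [|eta| > 1] and letting
      the prefix grow gives [eta^-M = delta^-M] for all large [M], so [eta = delta].
      If [delta] were transcendental, [eta] could be any large integer.
    - Taking [x = 1/b] with [b] divisible by a prime [q] and by the denominators of the
      [T_j] shows that [delta^N - 1] and [delta^-N - 1] are divisible by [q] in
      [Z[delta]], resp. [Z[1/delta]]; as [q] is arbitrary, [delta] is a unit.
    - If an embedding makes all [beta_i] positive, the right-hand side of the conjugated
      relation is nonnegative, so [delta] is sent to [eta >= 1], hence to itself. *)

(** * Geometric estimates, diagonal dominance, evaluation of rational and integral polynomials *)

Lemma bernoulli_le (R : realType) (a : R) n : 0 <= a -> 1 + n%:R * a <= (1 + a) ^+ n.
Proof.
move=> a0; elim: n => [|n IH]; first by rewrite mul0r addr0 expr0.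
have hn : 0 <= n%:R * a * a by rewrite !mulr_ge0.
rewrite exprS; apply: le_trans (_ : (1 + a) * (1 + n%:R * a) <= _); last first.
  by rewrite ler_pM2l //; lra.
rewrite -natr1; lra.
Qed.

Lemma expr_unbounded (R : realType) (a c : R) : 1 < a -> exists n, c < a ^+ n.
Proof.
move=> a1; have a0 : 0 < a - 1 by lra.
exists (Num.bound (c / (a - 1))).
have hn : c / (a - 1) < (Num.bound (c / (a - 1)))%:R.
  case: (lerP 0 (c / (a - 1))) => h; first exact: archi_boundP.
  exact: lt_le_trans h _.
have := @bernoulli_le R (a - 1) (Num.bound (c / (a - 1))) (ltW a0).
rewrite subrKC => h; apply: lt_le_trans h.
move: hn; rewrite ltr_pdivrMr //; lra.
Qed.

Lemma expr_arb_small (R : realType) (r e : R) :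
  0 <= r -> r < 1 -> 0 < e -> exists n, r ^+ n < e.
Proof.
move=> r0 r1 e0; have [->|rn0] := eqVneq r 0; first by exists 1%N; rewrite expr1.
have rp : 0 < r by rewrite lt_neqAle eq_sym rn0.
have [n hn] := @expr_unbounded R r^-1 e^-1 (etrans (invf_gt1 rp) r1).
exists n; move: hn; rewrite exprVn ltf_pV2 // posrE //; exact: exprn_gt0.
Qed.

Lemma le0_geometric (R : realType) (y c r : R) :
  0 <= r -> r < 1 -> (forall n, y <= c * r ^+ n) -> y <= 0.
Proof.
move=> r0 r1 h; rewrite leNgt; apply/negP => y0.
have c0 : 0 < c by have := h 0%N; rewrite expr0; lra.
have [n hn] := @expr_arb_small R r (y / c) r0 r1 (divr_gt0 y0 c0).
by have := h n; move: hn; rewrite ltr_pdivlMr //; lra.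
Qed.

(** Multiplying by [1 - |u|] telescopes the sum of the [|u| ^+ k]; one factor [|u| <= 1] is dropped.
    The bound does not depend on [n], a number of blocks that periodicity leaves uncontrolled. *)
Lemma geometric_tail (F : numFieldType) (u D : F) (a : nat -> F) m n :
  `|u| < 1 -> (forall k, `|a k| <= D) ->
  `|\sum_(m <= k < n) a k * u ^+ k.+1| <= D / (1 - `|u|) * `|u| ^+ m.
Proof.
move=> u1 aD; have h1 : 0 < 1 - `|u| by rewrite subr_gt0.
have D0 : 0 <= D := le_trans (normr_ge0 _) (aD 0%N).
rewrite mulrAC ler_pdivlMr //.
apply: le_trans (_ : (\sum_(m <= k < n) D * `|u| ^+ k) * (1 - `|u|) <= _).
  rewrite ler_pM2r //; apply: (le_trans (ler_norm_sum _ _ _)).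
  apply: ler_sum => k _; rewrite normrM normrX; apply: ler_pM => //; rewrite ?exprn_ge0 //.
  by rewrite exprS ler_piMl // ?exprn_ge0 // ltW.
rewrite -mulr_sumr -mulrA ler_wpM2l //.
have [le_mn|lt_nm] := leqP m n; last first.
  by rewrite big_geq ?mul0r ?exprn_ge0 // ltnW.
have -> : (\sum_(m <= i < n) `|u| ^+ i) * (1 - `|u|) = `|u| ^+ m - `|u| ^+ n.
  have := telescope_sumr (fun k => `|u| ^+ k) le_mn => /(congr1 -%R).
  rewrite opprB => <-; rewrite mulr_suml -sumrN; apply: eq_bigr => k _.
  by rewrite opprB exprSr mulrBr mulr1.
by rewrite lerBlDr lerDl exprn_ge0.
Qed.

(** Levy-Desplanques: in the row where a kernel vector has its entry of largest modulus, the
    diagonal term cannot be cancelled by the others. *)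
Lemma diag_dominant_det_neq0 (R : realFieldType) n (A : 'M[R]_n) :
  (forall i, \sum_(j | j != i) `|A i j| < `|A i i|) -> \det A != 0.
Proof.
move=> dom; apply/negP; rewrite -det_tr => /det0P [v v0 vA].
have [i0 vi0] : exists i, v 0 i != 0.
  apply/existsP; rewrite -negb_forall; apply: contra v0 => /forallP h.
  by apply/eqP/rowP => i; rewrite mxE; apply/eqP; have := h i; rewrite ?negbK.
have [i _ imax] := @Order.TotalTheory.arg_maxP _ _ _ i0 xpredT (fun i => `|v 0 i|) isT.
have vi : 0 < `|v 0 i| by apply: lt_le_trans (imax i0 isT); rewrite normr_gt0.
have : (v *m A^T) 0 i = 0 by rewrite vA mxE.
rewrite mxE (bigD1 i) //= mxE => /eqP; rewrite addr_eq0 => /eqP e.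
have := dom i; apply/negP; rewrite -leNgt -(ler_pM2l vi) -normrM e normrN.
apply: (le_trans (ler_norm_sum _ _ _)); rewrite mulr_sumr; apply: ler_sum => j _.
by rewrite mxE normrM ler_wpM2r //; exact: imax.
Qed.

Lemma map_poly_ratr_int (F : numFieldType) (g : {poly int}) :
  map_poly (ratr : rat -> F) (map_poly intr g) = map_poly intr g.
Proof. by apply/polyP => i; rewrite !coef_map /= ratr_int. Qed.

Lemma horner_ratr_complex (R : realType) (g : {poly rat}) (x : R) :
  (map_poly ratr g).[(x%:C)%C] = (((map_poly ratr g).[x])%:C)%C.
Proof.
have -> : map_poly (ratr : rat -> R[i]) g = map_poly (real_complex R) (map_poly ratr g).
  by apply/polyP => i; rewrite !coef_map /= fmorph_rat.
by rewrite horner_map.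
Qed.

(** Reversing the coefficients of [g] amounts to multiplying [g(z)] by a power of [z^-1]. *)
Lemma root_reciprocal (F : fieldType) (g : {poly int}) (z : F) :
  z != 0 -> root (map_poly intr g) z ->
  root (map_poly intr (\poly_(i < size g) g`_(size g - i.+1))) z^-1.
Proof.
move=> z0; rewrite !rootE => /eqP gz.
apply/eqP; apply: (mulfI (expf_neq0 (size g).-1 z0)); rewrite mulr0 -gz.
have -> : map_poly (intr : int -> F) (\poly_(i < size g) g`_(size g - i.+1)) =
   \poly_(i < size g) (g`_(size g - i.+1))%:~R.
  by apply/polyP => i; rewrite coef_map /= !coef_poly; case: ifP.
rewrite horner_poly [in RHS]/map_poly horner_poly big_distrr /= (reindex_inj rev_ord_inj) /=.
apply: eq_bigr => i _.
have -> : (size g - (size g - i.+1).+1 = i)%N by rewrite subnSK ?subKn // ltnW.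
rewrite [LHS]mulrCA; congr (_ * _).
have -> : (size g).-1 = (i + (size g - i.+1))%N
  by case: (size g) i => [[]|n] // [i /= hi]; rewrite subSS subnKC.
by rewrite exprVn exprD mulfK // expf_neq0.
Qed.

(** * Integrality *)

(** Take an annihilator of least size: the remainder of any other one modulo it still vanishes at
    [z], hence is zero. *)
Lemma annihilator_generator (F : numFieldType) (z : F) (g : {poly rat}) :
  g != 0 -> root (map_poly ratr g) z ->
  exists f : {poly rat}, [/\ f != 0, root (map_poly ratr f) z
    & forall h : {poly rat}, root (map_poly ratr h) z -> f %| h].
Proof.
move=> g0 gz.
pose P n := `[<exists f : {poly rat}, [/\ f != 0, root (map_poly ratr f) z & size f = n]>].
have exP : exists n, P n by exists (size g); apply/asboolP; exists g.
case: (ex_minnP exP) => n /asboolP [f [f0 fz <-]] fmin.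
exists f; split=> // h hz; apply: contraT => nfh.
have nz : h %% f != 0 by [].
have : (size f <= size (h %% f)%R)%N; last by rewrite leqNgt ltn_modp f0.
apply: fmin; apply/asboolP; exists (h %% f); split=> //.
rewrite map_modp rootE; move: hz; rewrite rootE {1}(divp_eq (map_poly ratr h) (map_poly ratr f)).
by rewrite hornerD hornerM (eqP fz) mulr0 add0r.
Qed.

(** For algebraic [z] the denominator is invertible modulo the generator [f] of the annihilators, so
    [y] is a polynomial in [z], and [c] clears its rational coefficients. *)
Lemma in_Qadj_integer_multiple (R : realType) (z y : R) (g : {poly rat}) :
  g != 0 -> root (map_poly ratr g) z -> in_Qadj z y ->
  exists2 c : int, c != 0 &
    exists H : {poly int}, c%:~R * y = (map_poly intr H).[z].
Proof.
move=> g0 gz [A [B [Bz ->]]].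
have [f [f0 fz fmin]] := annihilator_generator g0 gz.
(* The gcd does not vanish at [z], since [B] does not; so the cofactor [e] does, and minimality of
   [f] forces the gcd to be constant. *)
have cop : coprimep f B.
  have [e fe] : exists e, f = e * gcdp f B by exists (f %/ gcdp f B); rewrite divpK ?dvdp_gcdl.
  have dz : ~~ root (map_poly ratr (gcdp f B)) z.
    apply: contra Bz; rewrite -rootE => dz.
    by rewrite -(divpK (dvdp_gcdr f B)) rmorphM /= rootM dz orbT.
  have ez : root (map_poly ratr e) z.
    by move: fz; rewrite {1}fe rmorphM /= rootM (negbTE dz) orbF.
  have e0 : e != 0 by apply: contraNneq f0 => e0; rewrite fe e0 mul0r.
  have d0 : gcdp f B != 0 by rewrite gcdp_eq0 negb_and f0.
  have := dvdp_leq e0 (fmin _ ez); rewrite {1}fe size_mul //.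
  have := d0; rewrite -size_poly_gt0 coprimep_def; case: (size _) => // n _.
  have := e0; rewrite -size_poly_gt0; case: (size e) => // m _.
  by rewrite addnS /=; case: n => //; lia.
have [[U V] /= UV] := Bezout_eq1_coprimepP _ _ cop.
have UB : (map_poly ratr V).[z] * (map_poly ratr B).[z] = 1.
  have := congr1 (fun p => (map_poly (ratr : rat -> R) p).[z]) UV.
  by rewrite /= rmorphD !rmorphM /= hornerD !hornerM (eqP fz) mulr0 add0r rmorph1 hornerC.
have [H [a a0 e]] := rat_poly_scale (A * V).
exists a => //; exists H.
have -> : (map_poly ratr A).[z] / (map_poly ratr B).[z] = (map_poly ratr (A * V)).[z].
  by rewrite rmorphM hornerM; apply: (mulIf Bz); rewrite mulfVK // -mulrA UB mulr1.
rewrite e linearZ /= map_poly_ratr_int hornerZ.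
rewrite fmorphV /= ratr_int mulVKf //.
by rewrite intr_eq0.
Qed.

Lemma in_Qadj_common_multiple (R : realType) (z : R) (g : {poly rat}) (T : nat -> R) p :
  g != 0 -> root (map_poly ratr g) z -> (forall j, (j < p)%N -> in_Qadj z (T j)) ->
  exists2 c : int, c != 0 & forall j, (j < p)%N ->
    exists H : {poly int}, c%:~R * T j = (map_poly intr H).[z].
Proof.
move=> g0 gz; elim: p => [|p IH] hT; first by exists 1.
have [c c0 hc] := IH (fun j hj => hT j (ltnW hj)).
have [d d0 [H hd]] := in_Qadj_integer_multiple g0 gz (hT p (ltnSn p)).
exists (c * d); first by rewrite mulf_neq0.
move=> j; rewrite ltnS leq_eqVlt => /orP[/eqP->|/hc [H' hH']].
  by exists (c%:P * H); rewrite intrM rmorphM /= map_polyC hornerM hornerC -hd mulrA.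
by exists (d%:P * H'); rewrite intrM rmorphM /= map_polyC hornerM hornerC -hH' mulrA [_ * c%:~R]mulrC.
Qed.

(* With [x = 1 / (c q (b0 + 1))] the hypothesis says [z^N - 1 = q G(z)] with [G]
   integral, so by Gauss the prime [q] cannot divide the constant coefficient of the
   primitive minimal polynomial of [z]; hence that coefficient is a unit. *)
Lemma inv_algebraic_integer (R : realType) (z : R) (g : {poly rat}) (T : nat -> R) (p b0 : nat) :
  z != 0 -> g != 0 -> root (map_poly ratr g) z ->
  (forall j, (j < p)%N -> in_Qadj z (T j)) ->
  (forall b : nat, (b0 < b)%N -> exists N, exists2 S : nat -> {poly int}, (0 < N)%N &
     b%:R^-1 * (z ^+ N - 1) = \sum_(j < p) T j * (map_poly intr (S j)).[z]) ->
  algebraic_integer z^-1.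
Proof.
move=> z0 g0 gz hT hrel.
have [c c0 hc] := in_Qadj_common_multiple g0 gz hT.
have [f [f0 fz fmin]] := annihilator_generator g0 gz.
have [f1 [a a0 fE]] := rat_poly_scale f.
have aQ0 : (a%:~R : rat)^-1 != 0 by rewrite invr_eq0 intr_eq0.
pose h := zprimitive f1.
have f1z : root (map_poly intr f1) z.
  move: fz; rewrite fE linearZ /= map_poly_ratr_int rootZ //.
  by rewrite fmorph_eq0.
have f10 : f1 != 0 by apply: contraNneq f0 => e; rewrite fE e map_poly0 scaler0.
have hz : root (map_poly intr h) z.
  move: f1z; rewrite {1}(zpolyEprim f1) linearZ /= rootZ //.
  by rewrite intr_eq0 zcontents_eq0.
have nodiv q : prime q -> ~~ (q %| h`_0)%Z.
  move=> qp; apply/negP => qh.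
  (* A multiple of [q] and of [c] that exceeds [b0]. The absolute value of [c] is compensated by the
     factor [sgz c] in [G] below. *)
  pose b := (`|c| * (q * b0.+1))%N.
  have cn0 : (0 < `|c|)%N by rewrite absz_gt0.
  have q0 := prime_gt0 qp.
  have [|N [S N0 e]] := hrel b.
    by rewrite /b; nia.
  have [G hG] : exists G : {poly int}, z ^+ N - 1 = q%:R * (map_poly intr G).[z].
    have hH j : exists H : {poly int}, (j < p)%N -> c%:~R * T j = (map_poly intr H).[z].
      case: (ltnP j p) => hj; last by exists 0.
      by have [H hH] := hc j hj; exists H.
    have {hH} [H hH] := choice hH.
    exists ((sgz c * Posz b0.+1)%:P * \sum_(j < p) H j * S j).
    have bz : (b%:R : R) != 0 by rewrite pnatr_eq0 /b; nia.
    have -> : z ^+ N - 1 = b%:R * (b%:R^-1 * (z ^+ N - 1)) by rewrite mulVKf.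
    rewrite e [map_poly _ (_ * _)]rmorphM /= map_polyC hornerM hornerC rmorph_sum horner_sum /= !mulr_sumr.
    apply: eq_bigr => j _; rewrite [map_poly _ (_ * _)]rmorphM /= hornerM -hH //.
    have -> : (b%:R : R) = q%:R * (sgz c * b0.+1)%:~R * c%:~R.
      have -> : (b%:R : R) = `|c|%N%:R * (q%:R * b0.+1%:R) by rewrite /b !natrM.
      by rewrite [`|c|%N%:R]pmulrn abszEsg !intrM; ring.
    ring.
  have : f %| map_poly intr ('X^N - 1 - (Posz q)%:P * G).
    apply: fmin; rewrite map_poly_ratr_int rootE !rmorphB rmorphM /= map_polyXn rmorph1 map_polyC.
    by rewrite !hornerE hG subrr.
  (* By Gauss the primitive [h] divides over the integers. As [N > 0], the constant coefficients
     give [-1 - q G_0 = h_0 r_0], so [q] would divide 1. *)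
  rewrite fE dvdpZl // dvdp_rat_int => /dvdpP_int [r] /(congr1 (fun p : {poly int} => p`_0)).
  rewrite !coefB coefXn coef1 coefCM coef0M -/h.
  case/dvdzP: qh => k ->; rewrite eq_sym (gtn_eqF N0) /= => eq0.
  have : (q %| 1)%Z.
    by apply/dvdzP; exists (- (G`_0 + k * r`_0)); move: eq0; set x := G`_0; set y := r`_0; nia.
  by rewrite dvdzE /= dvdn1 => /eqP q1; rewrite q1 in qp.
(* An integer without prime divisors is 1 or -1; the value 0 is excluded by the prime 2. *)
have h0 : (absz h`_0) = 1%N :> nat.
  have [//|n1] := eqVneq (absz h`_0) 1%N.
  have [e|nz] := eqVneq (absz h`_0) 0%N; first by have := nodiv 2%N isT; rewrite dvdzE /= e.
  have gt1 : (1 < absz (h`_0)%R)%N by move: n1 nz; lia.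
  by have := nodiv _ (pdiv_prime gt1); rewrite dvdzE pdiv_dvd.
have sh : (0 < size h)%N by rewrite size_poly_gt0 zprimitive_eq0.
(* The reversed polynomial has leading coefficient [h_0], a sign, so scaling by [h_0] makes it
   monic. *)
set k := \poly_(i < size h) h`_(size h - i.+1).
have kz : root (map_poly intr k) z^-1 by apply: root_reciprocal.
have sk : size k = size h.
  by rewrite size_poly_eq // prednK // subnn -absz_eq0 h0.
have lk : lead_coef k = h`_0 by rewrite lead_coefE sk coef_poly prednK // leqnn subnn.
exists (h`_0 *: k); split.
  by rewrite monicE lead_coefZ lk; apply/eqP; move: h0; lia.
by rewrite linearZ /= rootZ // intr_eq0 -absz_eq0 h0.
Qed.

(** * The field generated by a real number and its embeddings *)

Section Qadj.
Variables (R : realType) (d : R).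

Lemma in_Qadj_horner (g : {poly rat}) : in_Qadj d (map_poly ratr g).[d].
Proof. by exists g, 1; rewrite rmorph1 hornerC oner_neq0 divr1. Qed.

Lemma in_Qadj_ratr q : in_Qadj d (ratr q).
Proof. by have := in_Qadj_horner q%:P; rewrite map_polyC hornerC. Qed.

Lemma in_Qadj_gen : in_Qadj d d.
Proof. by have := in_Qadj_horner 'X; rewrite map_polyX hornerX. Qed.

Lemma in_QadjD x y : in_Qadj d x -> in_Qadj d y -> in_Qadj d (x + y).
Proof.
move=> [A [B [B0 ->]]] [A' [B' [B'0 ->]]]; exists (A * B' + A' * B), (B * B').
by rewrite rmorphD !rmorphM /= hornerD !hornerM mulf_neq0 // addf_div.
Qed.

Lemma in_QadjM x y : in_Qadj d x -> in_Qadj d y -> in_Qadj d (x * y).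
Proof.
move=> [A [B [B0 ->]]] [A' [B' [B'0 ->]]]; exists (A * A'), (B * B').
by rewrite !rmorphM /= !hornerM mulf_neq0 // mulf_div.
Qed.

Lemma in_QadjV x : in_Qadj d x -> in_Qadj d x^-1.
Proof.
move=> [A [B [B0 ->]]]; have [e|A0] := eqVneq (map_poly ratr A).[d] 0.
  by rewrite e mul0r invr0 -[0](rmorph0 ratr); apply: in_Qadj_ratr.
by exists B, A; rewrite A0 invf_div.
Qed.

End Qadj.

(** Serves to move the suffix products from [Q(delta)] to [Q(1/delta)]. *)
Lemma in_Qadj_trans (R : realType) (d e y : R) : in_Qadj e d -> in_Qadj d y -> in_Qadj e y.
Proof.
move=> ed; suff h (g : {poly rat}) : in_Qadj e (map_poly ratr g).[d].
  by move=> [A [B [_ ->]]]; apply: in_QadjM => //; apply: in_QadjV.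
elim/poly_ind: g => [|g c IH].
  by rewrite map_poly0 horner0 -[0](rmorph0 ratr); apply: in_Qadj_ratr.
rewrite rmorphD rmorphM /= map_polyX map_polyC hornerMXaddC.
by apply: in_QadjD (in_Qadj_ratr _ _); apply: in_QadjM.
Qed.

Section Embedding.
Variables (R : realType) (d : R) (psi : R -> R[i]).
Hypothesis emb : field_embedding d psi.

Let in0 : in_Qadj d 0. Proof. by rewrite -[0](rmorph0 ratr); apply: in_Qadj_ratr. Qed.
Let in1 : in_Qadj d 1. Proof. by rewrite -[1](rmorph1 ratr); apply: in_Qadj_ratr. Qed.

Lemma embedding0 : psi 0 = 0.
Proof.
case: emb => _ [hD _]; have := hD 0 0 in0 in0; rewrite addr0 => e.
by apply: (addrI (psi 0)); rewrite addr0 -e.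
Qed.

Lemma embedding_int (m : int) : psi m%:~R = m%:~R.
Proof.
case: emb => h1 [hD _].
have inat (n : nat) : in_Qadj d n%:R by rewrite -(rmorph_nat ratr); apply: in_Qadj_ratr.
have hn (n : nat) : psi n%:R = n%:R.
  by elim: n => [|n IH]; rewrite ?embedding0 // -!natr1 hD // IH h1.
case: m => n; first exact: hn.
rewrite NegzE !mulrNz -!pmulrn; apply/eqP; rewrite -addr_eq0 -[X in _ + X]hn.
rewrite -hD // ?addNr ?embedding0 //.
by rewrite -[- _]mul1r mulrN -mulNr -(rmorphN1 ratr); apply: in_QadjM => //; apply: in_Qadj_ratr.
Qed.

Lemma embeddingM_eq1 x : in_Qadj d x -> x != 0 -> psi x * psi x^-1 = 1.
Proof.
move=> hx x0; case: emb => h1 [_ hM]; rewrite -hM ?divff //; exact: in_QadjV.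
Qed.

Lemma embedding_neq0 x : in_Qadj d x -> x != 0 -> psi x != 0.
Proof.
by move=> hx /(embeddingM_eq1 hx) e; apply/eqP => z; move: e; rewrite z mul0r => /esym/eqP; rewrite oner_eq0.
Qed.

Lemma embeddingV x : in_Qadj d x -> psi x^-1 = (psi x)^-1.
Proof.
move=> hx; have [->|x0] := eqVneq x 0; first by rewrite invr0 embedding0 invr0.
by apply: (mulfI (embedding_neq0 hx x0)); rewrite embeddingM_eq1 // divff // embedding_neq0.
Qed.

Lemma embedding_rat (q : rat) : psi (ratr q) = ratr q.
Proof.
case: emb => _ [_ hM].
have hi (m : int) : in_Qadj d m%:~R by rewrite -(ratr_int R); apply: in_Qadj_ratr.
rewrite -[q]divq_num_den !rmorphM /= !fmorphV /= !ratr_int.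
by rewrite hM ?embeddingV ?embedding_int //; apply: in_QadjV.
Qed.

Lemma embedding_horner (g : {poly rat}) :
  psi (map_poly ratr g).[d] = (map_poly ratr g).[psi d].
Proof.
case: emb => _ [hD hM].
elim/poly_ind: g => [|g c IH]; first by rewrite !map_poly0 !horner0 embedding0.
rewrite !rmorphD !rmorphM /= !map_polyX !map_polyC !hornerMXaddC.
have hg := in_Qadj_horner d g; have hd := in_Qadj_gen d.
have hc := in_Qadj_ratr d c; have hgd := in_QadjM hg hd.
by rewrite hD // hM // IH embedding_rat.
Qed.

(** The induction carries membership in [Q(d)] along: [psi] is a map on all of [R] whose
    multiplicativity is assumed only there. *)
Lemma embedding_prod (I : Type) (r : seq I) (P : pred I) (f : I -> R) :
  (forall i, P i -> in_Qadj d (f i)) ->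
  psi (\prod_(i <- r | P i) f i) = \prod_(i <- r | P i) psi (f i).
Proof.
move=> h; case: emb => h1 [_ hM].
suff [] : in_Qadj d (\prod_(i <- r | P i) f i) /\
  psi (\prod_(i <- r | P i) f i) = \prod_(i <- r | P i) psi (f i) by [].
apply: (big_ind2 (fun x y => in_Qadj d x /\ psi x = y)) => //.
- by move=> x1 y1 x2 y2 [i1 <-] [i2 <-]; split; [exact: in_QadjM|exact: hM].
- by move=> i Pi; split=> //; apply: h.
Qed.

Lemma embedding_sum (I : Type) (r : seq I) (P : pred I) (f : I -> R) :
  (forall i, P i -> in_Qadj d (f i)) ->
  psi (\sum_(i <- r | P i) f i) = \sum_(i <- r | P i) psi (f i).
Proof.
move=> h; case: emb => h1 [hD _].
suff [] : in_Qadj d (\sum_(i <- r | P i) f i) /\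
  psi (\sum_(i <- r | P i) f i) = \sum_(i <- r | P i) psi (f i) by [].
apply: (big_ind2 (fun x y => in_Qadj d x /\ psi x = y)) => //.
- by rewrite embedding0.
- by move=> x1 y1 x2 y2 [i1 <-] [i2 <-]; split; [exact: in_QadjD|exact: hD].
- by move=> i Pi; split=> //; apply: h.
Qed.

End Embedding.

(** The gcd of [P] and [g] vanishes at [z], so it is not constant, and irreducibility makes it
    associate to [P]. Used at [delta] and at its complex conjugates, to carry relations from one to
    the other. *)
Lemma root_irreducible_dvdp (F : numFieldType) (P g : {poly rat}) (z : F) :
  irreducible_poly P -> root (map_poly ratr P) z -> root (map_poly ratr g) z -> P %| g.
Proof.
move=> irrP Pz gz.
have gcdz : root (map_poly ratr (gcdp P g)) z by rewrite gcdp_map root_gcd Pz.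
have : size (gcdp P g) != 1%N.
  apply/negP => /size_poly1P [c c0 e]; move: gcdz.
  by rewrite e map_polyC rootC fmorph_eq0 (negbTE c0).
move/(irrP.2 _)/(_ (dvdp_gcdl _ _)) => e.
by rewrite -(eqp_dvdl _ e) dvdp_gcdr.
Qed.

(** * Greedy expansions *)

Definition base_prod (R : realType) (bs : seq R) (k : nat) : R :=
  \prod_(i < k) base_at bs i.

(** The weight of digit [j] inside a block of [p] digits. Indices start at 0, so this is [T_(j+1)]
    in one-based notation, and [j = p - 1] gives the empty product. *)
Definition base_suffix (R : realType) (bs : seq R) (j : nat) : R :=
  \prod_(j.+1 <= i < size bs) base_at bs i.

(** Kept as an integral polynomial so that the same digits can be evaluated at [delta], at its
    conjugates and at natural numbers. *)
Definition digit_poly (a : nat -> int) (p N j : nat) : {poly int} :=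
  \sum_(k < N) (a (k * p + j)%N)%:P * 'X^(N - k.+1).

Lemma horner_digit_poly (F : numFieldType) (z : F) a p N j :
  (map_poly intr (digit_poly a p N j)).[z] =
  \sum_(k < N) (a (k * p + j)%N)%:~R * z ^+ (N - k.+1).
Proof.
rewrite rmorph_sum horner_sum; apply: eq_bigr => k _.
by rewrite rmorphM /= map_polyC map_polyXn hornerM hornerC hornerXn.
Qed.

(** Factoring out [z ^+ N] leaves a series in [z^-1], whose tail is small when [|z| > 1]. *)
Lemma horner_digit_polyV (F : numFieldType) (z : F) a p N j : z != 0 ->
  (map_poly intr (digit_poly a p N j)).[z] =
  z ^+ N * \sum_(0 <= k < N) (a (k * p + j)%N)%:~R * z^-1 ^+ k.+1.
Proof.
move=> z0; rewrite horner_digit_poly big_mkord mulr_sumr; apply: eq_bigr => k _.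
rewrite mulrCA exprVn; congr (_ * _); apply: (mulIf (expf_neq0 k.+1 z0)).
by rewrite -exprD subnK ?ltn_ord // divfK ?expf_neq0.
Qed.

Section Expansion.
Variables (R : realType) (bs : seq R).
Hypothesis hb : alt_base bs.
Local Notation p := (size bs).
Local Notation b := (base_at bs).
Local Notation B := (base_prod bs).
Local Notation T := (base_suffix bs).
Local Notation delta := (\prod_(b <- bs) b).

Let p_gt0 : (0 < p)%N. Proof. by case: hb. Qed.

Lemma base_at_gt1 k : 1 < b k.
Proof. by case: hb => p0; apply; rewrite ltn_pmod. Qed.

Let b_gt0 k : 0 < b k. Proof. exact: lt_trans (base_at_gt1 k). Qed.

Lemma base_at_period m k : b (m * p + k) = b k.
Proof. by rewrite /base_at modnMDl. Qed.

Lemma base_prodS k : B k.+1 = B k * b k.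
Proof. exact: big_ord_recr. Qed.

Lemma base_prod_size : B p = delta.
Proof.
rewrite /base_prod (big_nth 0) big_mkord; apply: eq_bigr => i _.
by rewrite /base_at modn_small.
Qed.

Lemma base_prod_period m t : B (m * p + t) = delta ^+ m * B t.
Proof.
have h l n : B (l * p + n) = B (l * p) * B n.
  elim: n => [|n IH]; first by rewrite addn0 /base_prod [X in _ * X]big_ord0 mulr1.
  by rewrite addnS !base_prodS IH base_at_period mulrA.
rewrite h; congr (_ * _); elim: m => [|m IH]; first by rewrite mul0n expr0 /base_prod big_ord0.
by rewrite mulSn addnC h IH base_prod_size exprSr.
Qed.

Lemma base_prod_gt0 k : 0 < B k.
Proof. by apply: prodr_gt0 => i _. Qed.

Lemma base_prod_homo : {homo B : m n / (m <= n)%N >-> m <= n}.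
Proof.
apply: (homo_leq (@lexx _ R) le_trans) => k.
by rewrite base_prodS ler_peMr ?ltW ?base_prod_gt0 ?base_at_gt1.
Qed.

Lemma base_suffix_last : T p.-1 = 1.
Proof. by rewrite /base_suffix prednK // big_geq. Qed.

Lemma delta_gt1 : 1 < delta.
Proof.
rewrite -base_prod_size; apply: lt_le_trans (base_prod_homo p_gt0).
by rewrite base_prodS /base_prod big_ord0 mul1r base_at_gt1.
Qed.

Lemma base_suffix_neq0 j : T j != 0.
Proof. by apply: lt0r_neq0; apply: prodr_gt0 => i _. Qed.

Lemma base_suffix_rec j : (j.+1 < p)%N -> T j = nth 0 bs j.+1 * T j.+1.
Proof.
by move=> hj; rewrite /base_suffix big_ltn // /base_at modn_small.
Qed.

Lemma delta_suffix : delta = nth 0 bs 0 * T 0.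
Proof.
rewrite -base_prod_size /base_prod -(big_mkord xpredT b) /base_suffix big_ltn //.
by rewrite /base_at mod0n.
Qed.

Lemma ab_rem_itv x k : 0 <= x < 1 -> 0 <= ab_rem bs x k < 1.
Proof.
move=> hx; case: k => [|k] //=.
have := floor_itv (b k * ab_rem bs x k); rewrite intrD; lra.
Qed.

Lemma ab_digit_itv x k : 0 <= x < 1 -> 0 <= (ab_digit bs x k)%:~R :> R /\ (ab_digit bs x k)%:~R <= b k.
Proof.
move=> /(@ab_rem_itv x k) /andP[r0 r1].
have := floor_itv (b k * ab_rem bs x k) => /andP[h1 h2].
have h0 : 0 <= b k * ab_rem bs x k by rewrite mulr_ge0 // ltW.
split; first by rewrite ler0z /ab_digit floor_ge0.
apply: (le_trans h1); rewrite ler_piMr // ltW //.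
Qed.

(** A crude bound uniform in [k], later used to bound all digits. *)
Lemma base_at_le_sum k : b k <= \sum_(c <- bs) c.
Proof.
rewrite (big_nth 0) big_mkord (bigD1 (Ordinal (ltn_pmod k p_gt0))) //= lerDl.
by apply: sumr_ge0 => i _; apply: ltW; apply: lt_trans (hb.2 i _).
Qed.

Lemma ab_rem_block x m t : (t <= p)%N ->
  ab_rem bs x (m * p + t) = B t * ab_rem bs x (m * p)
   - \sum_(j < t) (ab_digit bs x (m * p + j))%:~R * \prod_(j.+1 <= i < t) b i.
Proof.
elim: t => [|t IH] ht; first by rewrite addn0 big_ord0 subr0 /base_prod big_ord0 mul1r.
rewrite addnS /= -/(ab_digit bs x (m * p + t)) base_at_period IH 1?ltnW //.
rewrite base_prodS big_ord_recr /= [in RHS]big_geq // mulr1 mulrBr mulr_sumr.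
under [in RHS]eq_bigr => j _ do rewrite big_nat_recr //=.
rewrite opprD addrA; congr (_ - _ - _); first by ring.
by apply: eq_bigr => j _; ring.
Qed.

(** A full block of digits multiplies the remainder by [delta] and subtracts the digits weighted by
    the [T j]; iterating this is a Horner scheme in [delta]. *)
Lemma ab_rem_blocks x N :
  ab_rem bs x (N * p) = delta ^+ N * x
   - \sum_(j < p) T j * (map_poly intr (digit_poly (ab_digit bs x) p N j)).[delta].
Proof.
under [X in _ - X]eq_bigr => j _ do rewrite horner_digit_poly.
elim: N => [|N IH].
  by rewrite expr0 mul1r mul0n /= big1 ?subr0 // => j _; rewrite big_ord0 mulr0.
rewrite mulSn addnC ab_rem_block // IH base_prod_size exprS mulrBr mulrA -addrA -opprD.
congr (_ - _); rewrite mulr_sumr -big_split /=; apply: eq_bigr => j _.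
rewrite big_ord_recr /= subnn expr0 mulr1 mulrDr; congr (_ + _); last by rewrite mulrC.
rewrite mulrCA; congr (_ * _); rewrite mulr_sumr; apply: eq_bigr => k _.
by rewrite subSn // exprS; ring.
Qed.

(** The shift is a multiple of [p], so [r_(k+np)] and [r_k] follow the same affine recursion and
    their difference is multiplied by [B k]. Remainders stay in [[0, 1)], so the initial difference
    must vanish. *)
Lemma periodic_ab_rem x n : 0 <= x < 1 ->
  (forall k, ab_digit bs x (k + n * p) = ab_digit bs x k) ->
  ab_rem bs x (n * p) = x.
Proof.
move=> hx per.
have diff k : ab_rem bs x (k + n * p) - ab_rem bs x k = B k * (ab_rem bs x (n * p) - x).
  elim: k => [|k IH]; first by rewrite add0n /base_prod big_ord0 mul1r.
  rewrite addSn /= -!/(ab_digit bs x _) per base_prodS addnC base_at_period addnC.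
  rewrite -mulrA [RHS]mulrCA -IH.
  by rewrite [(k + _)%N]addnC; ring.
have d1 := delta_gt1; have d0 : 0 < delta by lra.
apply/eqP; rewrite -subr_eq0 -normr_le0.
apply: (@le0_geometric R _ 1 delta^-1); rewrite ?invr_ge0 ?ltW ?invf_lt1 // => m.
rewrite mul1r exprVn -[_^-1]mul1r ler_pdivlMr ?exprn_gt0 //.
have := diff (m * p)%N.
have -> : B (m * p) = delta ^+ m.
  by rewrite -[(m * p)%N]addn0 base_prod_period /base_prod [X in _ * X]big_ord0 mulr1.
move=> e; rewrite -(gtr0_norm (exprn_gt0 m d0)) -normrM mulrC -e.
have := @ab_rem_itv x (m * p + n * p) hx; have := @ab_rem_itv x (m * p) hx.
by rewrite ler_norml; lra.
Qed.

(** The remainders have the closed form [B k * (x - [J < k] v)], proved by induction together with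
    the digits. *)
Lemma cylinder_digits J Q x : (J < Q)%N ->
  (B J.+1)^-1 <= x -> x < (B J)^-1 -> x - (B J.+1)^-1 < (B Q)^-1 ->
  forall k, (k < Q)%N -> ab_digit bs x k = (k == J)%:R.
Proof.
move=> JQ x1 x2 x3; set v := (B J.+1)^-1 in x1 x3.
have Bv : B J.+1 * v = 1 by rewrite divff // lt0r_neq0 // base_prod_gt0.
have v0 : 0 < v by rewrite invr_gt0 base_prod_gt0.
(* Before [J] the floor is 0 because [x < 1 / B J]; after [J] because [x - v < 1 / B Q]; at [J]
   itself [B J.+1 * x] lies in [[1, 2)]. *)
have step k : (k < Q)%N -> ab_rem bs x k = B k * (x - (J < k)%N%:R * v) ->
    ab_digit bs x k = (k == J)%:R.
  move=> kQ e; apply: floor_def; rewrite e mulrA [b k * _]mulrC -base_prodS.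
  have Bk := base_prod_gt0 k.+1.
  case: (ltngtP k J) => [kJ|Jk|->] /=; rewrite ?mul0r ?subr0 ?mul1r.
  - rewrite mulr_ge0 /= ?(ltW (lt_le_trans v0 x1)) ?(ltW Bk) //.
    apply: le_lt_trans (_ : B J * x < _).
      by rewrite ler_wpM2r ?(ltW (lt_le_trans v0 x1)) ?base_prod_homo.
    by rewrite mulrC -ltr_pdivlMr ?base_prod_gt0 // mul1r.
  - rewrite mulr_ge0 ?subr_ge0 ?(ltW Bk) //=.
    apply: le_lt_trans (_ : B Q * (x - v) < _).
      by rewrite ler_wpM2r ?subr_ge0 ?base_prod_homo.
    by rewrite mulrC -ltr_pdivlMr ?base_prod_gt0 // mul1r.
  - have h1 : B J.+1 * v <= B J.+1 * x by rewrite ler_pM2l // base_prod_gt0.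
    have h2 : B J.+1 * (x - v) < 1.
      apply: le_lt_trans (_ : B Q * (x - v) < _).
        by rewrite ler_wpM2r ?subr_ge0 ?base_prod_homo.
      by rewrite mulrC -ltr_pdivlMr ?base_prod_gt0 // mul1r.
    by move: h1 h2; rewrite mulrBr Bv; lra.
suff remE k : (k <= Q)%N -> ab_rem bs x k = B k * (x - (J < k)%N%:R * v).
  by move=> k kQ; apply: step => //; apply: remE; apply: ltnW.
elim: k => [|k IH] kQ; first by rewrite /= /base_prod big_ord0 mul0r subr0 mul1r.
rewrite /= -/(ab_digit bs x k) (step k kQ (IH (ltnW kQ))) (IH (ltnW kQ)).
rewrite mulrA [b k * _]mulrC -base_prodS !mulrBr ltnS.
case: (ltngtP k J) => [kJ|Jk|->] /=; rewrite ?mul0r ?mul1r ?mulr0 ?subr0 //.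
by rewrite Bv.
Qed.

Lemma cylinder_rat J Q : (J < Q)%N -> exists q : rat,
  [/\ (B J.+1)^-1 < ratr q, ratr q < (B J)^-1, ratr q - (B J.+1)^-1 < (B Q)^-1
    & forall k, (k < Q)%N -> ab_digit bs (ratr q : R) k = (k == J)%:R].
Proof.
move=> JQ; set v := (B J.+1)^-1.
have vJ : v < (B J)^-1.
  rewrite ltf_pV2 ?posrE ?base_prod_gt0 // base_prodS ltr_pMr ?base_prod_gt0 //.
  exact: base_at_gt1.
have vQ : v < v + (B Q)^-1 by rewrite ltrDl invr_gt0 base_prod_gt0.
have [|q] := @rat_in_itvoo R v (Order.min (B J)^-1 (v + (B Q)^-1)).
  by rewrite lt_min vJ.
rewrite in_itv /= lt_min => /and3P[q1 q2 q3].
have q4 : ratr q - v < (B Q)^-1 by rewrite ltrBlDl.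
by exists q; split=> //; apply: cylinder_digits => //; apply: ltW.
Qed.

End Expansion.

(** * Conjugating the periodicity relation *)

Lemma complex_ge0_real (R : realType) (z : R[i]) : 0 <= z -> z = ((complex.Re z)%:C)%C.
Proof. by case: z => a b; rewrite lecE /= => /andP[/eqP -> _]. Qed.

(** The order on [R[i]] is partial, but [0 <= y <= c] makes both numbers real, which reduces the
    claim to real parts. *)
Lemma complex_eq0_geometric (R : realType) (y c : R[i]) (r : R) :
  0 <= r -> r < 1 -> 0 <= y -> (forall n, y <= c * (r%:C)%C ^+ n) -> y = 0.
Proof.
move=> r0 r1 y0 h; have c0 : 0 <= c by have := h 0%N; rewrite expr0 mulr1; apply: le_trans.
apply/eqP; rewrite eq_le y0 andbT (complex_ge0_real y0) -[0]/((0 : R)%:C)%C lecR.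
apply: (@le0_geometric R _ (complex.Re c) r) => // n; rewrite -lecR rmorphM rmorphXn /=.
by rewrite -!complex_ge0_real.
Qed.

(** The first [M + K + 1] blocks contain a single digit 1, at position [i] of block [M], and
    contribute exactly the subtracted term; the rest is a geometric tail. The field is arbitrary
    because both [1/delta] and a complex [1/eta] are substituted. *)
Lemma cylinder_sum (F : numFieldType) (u : F) (a : nat -> int) (D : int) (p M K N i j : nat) :
  `|u| < 1 -> (forall k, 0 <= a k <= D) -> (i < p)%N -> (j < p)%N -> (M + K < N)%N ->
  (forall k, (k < (M + K).+1 * p)%N -> a k = (k == M * p + i)%N%:R) ->
  `|\sum_(0 <= k < N) (a (k * p + j)%N)%:~R * u ^+ k.+1 - (j == i)%:R * u ^+ M.+1|
    <= D%:~R / (1 - `|u|) * `|u| ^+ (M + K).+1.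
Proof.
move=> u1 aD ip jp MKN acyl.
rewrite (@big_cat_nat _ _ _ (M + K).+1) //=.
have -> : \sum_(0 <= k < (M + K).+1) (a (k * p + j)%N)%:~R * u ^+ k.+1 = (j == i)%:R * u ^+ M.+1.
  rewrite big_mkord (bigD1 (Ordinal (leq_addr K M : (M < (M + K).+1)%N))) //= big1 => [|k kM].
    rewrite addr0 acyl; last by nia.
    by rewrite eqn_add2l; case: eqP.
  rewrite acyl; last by have := ltn_ord k; nia.
  have kM' : nat_of_ord k <> M by move=> e; case/eqP: kM; apply: val_inj.
  by case: eqP => [e|_]; rewrite ?mul0r //; exfalso; move: kM'; nia.
rewrite addrAC subrr add0r; apply: (@geometric_tail F u _ (fun k => (a (k * p + j)%N)%:~R)) => // k.
by have /andP[a0 aD'] := aD (k * p + j)%N; rewrite ger0_norm ?ler0z // ler_int.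
Qed.

Section PurelyPeriodic.
Variables (R : realType) (bs : seq R).
Hypotheses (hb : alt_base bs) (pp : property_PP bs).
Local Notation p := (size bs).
Local Notation T := (base_suffix bs).
Local Notation delta := (\prod_(b <- bs) b).
Local Notation S q := (digit_poly (ab_digit bs (ratr q : R)) p).

Let p_gt0 : (0 < p)%N. Proof. by case: hb. Qed.
Let d_gt1 : 1 < delta. Proof. exact: delta_gt1. Qed.
Let d_gt0 : 0 < delta. Proof. exact: lt_trans d_gt1. Qed.
Let w := delta^-1.
Let w_gt0 : 0 < w. Proof. by rewrite invr_gt0. Qed.
Let w_lt1 : w < 1. Proof. by rewrite invf_lt1. Qed.

Lemma PP_relation : exists2 gamma : R, 0 < gamma &
  forall q : rat, 0 <= (ratr q : R) -> (ratr q : R) < gamma ->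
    (ratr q : R) < 1 /\ forall K, exists2 N, (K < N)%N &
    ratr q * (delta ^+ N - 1) = \sum_(j < p) T j * (map_poly intr (S q N j)).[delta].
Proof.
case: pp => g [g0 hg]; exists (Order.min g 1); first by rewrite lt_min g0 ltr01.
move=> q q0; rewrite lt_min => /andP[qg q1]; split=> // K.
have [n [n0 per]] := hg q q0 qg q1.
have perM m k : ab_digit bs (ratr q : R) (k + m * n) = ab_digit bs (ratr q) k.
  by elim: m => [|m IH]; rewrite ?addn0 // mulSn addnCA addnC per.
(* This many blocks make [n * K.+1 * p] digits, a multiple of both the period [n] and the length
   [p]. *)
exists (n * K.+1)%N; first by nia.
have e := @periodic_ab_rem R bs hb (ratr q) (n * K.+1).
have : ab_rem bs (ratr q) (n * K.+1 * p) = ratr q :> R.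
  by apply: e => [|k]; [rewrite q0|rewrite -mulnA mulnC perM].
rewrite ab_rem_blocks // => e'; rewrite mulrBr mulr1 mulrC -[X in _ - X]e'.
by rewrite opprB addrC subrK.
Qed.

Lemma ab_digit_bound : exists2 D : int, 0 <= D & forall x k, 0 <= x < 1 -> 0 <= ab_digit bs x k <= D.
Proof.
exists (Num.floor (\sum_(c <- bs) c)).
  by rewrite floor_ge0; apply: le_trans (base_at_le_sum hb 0); apply: ltW; apply: lt_trans (base_at_gt1 hb 0).
move=> x k /(@ab_digit_itv _ _ hb x k) [h1 h2].
move: h1; rewrite ler0z => -> /=.
by rewrite floor_ge_int; apply: le_trans h2 (base_at_le_sum hb k).
Qed.

Lemma base_prod_inv_le m t : (base_prod bs (m * p + t))^-1 <= w ^+ m.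
Proof.
rewrite exprVn -[delta ^+ m]mulr1 lef_pV2 ?posrE ?mulr1 ?exprn_gt0 ?base_prod_gt0 //.
apply: le_trans (base_prod_homo hb (leq_addr t (m * p))).
by rewrite -[(m * p)%N]addn0 base_prod_period /base_prod [X in _ * X]big_ord0 mulr1.
Qed.

(** [M] and [i] place the digit 1, and [K] is the number of zero blocks that follow block [M]. Since
    [gamma] and [D] come first, [K] can grow while the constants stay fixed. *)
Lemma cylinder_relation : exists gamma : R, exists2 D : int, 0 < gamma /\ 0 <= D &
  forall M K i, w ^+ M < gamma -> (i < p)%N -> exists q : rat, exists N,
  [/\ `|ratr q - (base_prod bs (M * p + i.+1))^-1| <= w ^+ (M + K).+1 :> R,
      0 <= (ratr q : R) <= 1, (M + K < N)%N,
      ratr q * (delta ^+ N - 1) = \sum_(j < p) T j * (map_poly intr (S q N j)).[delta]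
    & forall (F : numFieldType) (u : F) j, `|u| < 1 -> (j < p)%N ->
      `|\sum_(0 <= k < N) (ab_digit bs (ratr q : R) (k * p + j))%:~R * u ^+ k.+1
         - (j == i)%:R * u ^+ M.+1| <= D%:~R / (1 - `|u|) * `|u| ^+ (M + K).+1].
Proof.
have [gamma g0 rel] := PP_relation; have [D D0 hD] := ab_digit_bound.
exists gamma, D => // M K i wg ip.
have JQ : (M * p + i < (M + K).+1 * p)%N by nia.
have [q [q1 q2 q3 q4]] := cylinder_rat hb JQ.
have q0 : 0 <= (ratr q : R) by apply: ltW; apply: lt_trans q1; rewrite invr_gt0 base_prod_gt0.
have qg : (ratr q : R) < gamma.
  by apply: lt_trans q2 _; apply: le_lt_trans wg; apply: base_prod_inv_le.
have [ql1 /(_ (M + K)%N) [N MN e]] := rel q q0 qg.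
exists q, N; split=> //.
- rewrite addnS ger0_norm ?subr_ge0 ?ltW //; apply: lt_le_trans q3 _.
  by rewrite -[((M + K).+1 * p)%N]addn0 base_prod_inv_le.
- by rewrite q0 ltW.
- move=> F u j u1 jp; apply: cylinder_sum => // k.
  by apply: hD; rewrite q0.
Qed.

(** One relation for each position [i] of the digit 1 gives a square system for the [T j] with
    coefficients in [Q[delta]], solved by Cramer's rule. Numerators and the common denominator
    remain polynomials, so that they can be conjugated. *)
Lemma suffix_in_field : exists2 B : {poly rat}, (map_poly ratr B).[delta] != 0 &
  exists A : nat -> {poly rat}, forall j, (j < p)%N ->
    (map_poly ratr B).[delta] * T j = (map_poly ratr (A j)).[delta].
Proof.
have [gamma [D [g0 D0] cyl]] := cylinder_relation.
have [M hM] := @expr_arb_small R w gamma (ltW w_gt0) w_lt1 g0.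
(* The [p] errors in a row sum to at most [p D / (1 - w) * w ^+ (M + K).+1], which has to be below
   [w ^+ M.+1]. The summand 1 keeps the constant invertible when [D = 0]. *)
have e0 : 0 < (p%:R * (D%:~R / (1 - w)) + 1)^-1.
  rewrite invr_gt0 ltr_wpDl // mulr_ge0 //.
  by rewrite divr_ge0 ?ler0z ?subr_ge0 ?(ltW w_lt1).
have [K hK] := @expr_arb_small R w _ (ltW w_gt0) w_lt1 e0.
have [q hq] := choice (fun i : 'I_p => cyl M K i hM (ltn_ord i)).
have [N {}hq] := choice hq.
pose phi : {rmorphism {poly rat} -> R} := horner_eval delta \o map_poly ratr.
have phiE g : phi g = (map_poly ratr g).[delta] by [].
pose A : 'M[{poly rat}]_p := \matrix_(i, j) map_poly intr (S (q i) (N i) j).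
pose r : 'cV[{poly rat}]_p := \col_i ((q i)%:P * ('X^(N i) - 1)).
pose v : 'cV[R]_p := \col_j T j.
have rel : map_mx phi A *m v = map_mx phi r.
  apply/matrixP => i j; rewrite !mxE phiE rmorphM rmorphB /= map_polyC map_polyXn rmorph1.
  rewrite !hornerE; have [_ _ _ -> _] := hq i; apply: eq_bigr => k _.
  by rewrite !mxE phiE map_poly_ratr_int mulrC.
have detA : phi (\det A) != 0.
  rewrite -det_map_mx; apply: diag_dominant_det_neq0 => i.
  have [_ _ _ _ est] := hq i.
  (* Up to the factor [delta ^+ N i], row [i] is close to [w ^+ M.+1] times the [i]-th unit
     vector. *)
  pose s j := \sum_(0 <= k < N i) (ab_digit bs (ratr (q i) : R) (k * p + j))%:~R * w ^+ k.+1.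
  have AE j : (map_mx phi A) i j = delta ^+ N i * s j.
    by rewrite !mxE phiE map_poly_ratr_int horner_digit_polyV ?lt0r_neq0.
  under eq_bigr => j _ do rewrite AE normrM.
  rewrite AE normrM -mulr_sumr ltr_pM2l ?normr_gt0 ?expf_neq0 ?lt0r_neq0 //.
  pose f (j : 'I_p) := `|s j - (j == i)%:R * w ^+ M.+1|.
  have wn : `|w| = w by rewrite ger0_norm ?ltW.
  have hf : \sum_j f j < w ^+ M.+1.
    apply: le_lt_trans (_ : \sum_(j < p) D%:~R / (1 - w) * w ^+ (M + K).+1 < _).
      apply: ler_sum => j _; apply: (le_trans (est R w j _ _)); by rewrite ?wn.
    rewrite sumr_const card_ord -mulr_natl.
    have -> : p%:R * (D%:~R / (1 - w) * w ^+ (M + K).+1) =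
        p%:R * (D%:~R / (1 - w)) * w ^+ K * w ^+ M.+1.
      by rewrite -addSn exprD [w ^+ M.+1 * _]mulrC !mulrA.
    rewrite -[ltRHS]mul1r ltr_pM2r ?exprn_gt0 //.
    apply: le_lt_trans (_ : (p%:R * (D%:~R / (1 - w)) + 1) * w ^+ K < 1).
      by rewrite ler_wpM2r ?exprn_ge0 ?ltW // ltrDl.
    by rewrite mulrC -ltr_pdivlMr ?mul1r //; move: e0; rewrite invr_gt0.
  move: hf; rewrite (bigD1 i) //= /f eqxx mul1r.
  have -> : \sum_(j < p | j != i) `|s j - (j == i)%:R * w ^+ M.+1| = \sum_(j < p | j != i) `|s j|.
    by apply: eq_bigr => j /negbTE ->; rewrite mul0r subr0.
  have := ler_normD (s i) (w ^+ M.+1 - s i); rewrite subrKC distrC.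
  rewrite (ger0_norm (exprn_ge0 _ (ltW w_gt0))).
  move: (\sum_(j < p | _) _) (w ^+ M.+1) `|s i| `|s i - w ^+ M.+1| => x1 x2 x3 x4; lra.
exists (\det A); first exact: detA.
(* The value 0 outside the range of indices is a mere default. *)
exists (fun j => if insub j is Some j' then (\adj A *m r) j' 0 else 0) => j hj.
rewrite insubT /= -!phiE.
have := congr1 (mulmx (\adj (map_mx phi A))) rel.
rewrite mulmxA mul_adj_mx -map_mx_adj -map_mxM det_map_mx mul_scalar_mx.
by move=> /(congr1 (fun X : 'cV_p => X (Ordinal hj) 0)); rewrite !mxE.
Qed.

(** The digit 1 is put last in block [M], where the suffix product is 1. As [|1/eta| < 1], the
    conjugated tails vanish when [K] grows. Besides avoiding the roots of [B], [eta] need only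
    satisfy the polynomial relations of [delta], which covers conjugates, images under embeddings
    and the transcendental case. *)
Lemma conjugate_outside_disk (B : {poly rat}) (A : nat -> {poly rat}) (eta : R[i]) :
  (forall j, (j < p)%N -> (map_poly ratr B).[delta] * T j = (map_poly ratr (A j)).[delta]) ->
  (forall g : {poly rat}, root (map_poly ratr g) delta -> root (map_poly ratr g) eta) ->
  (map_poly ratr B).[eta] != 0 -> 1 < `|eta| -> eta = (delta%:C)%C.
Proof.
move=> BA trans B0 eta1.
have [gamma [D [g0 D0] cyl]] := cylinder_relation.
have eta0 : eta != 0 by rewrite -normr_gt0; apply: lt_trans eta1.
pose u := eta^-1; have u1 : `|u| < 1 by rewrite normfV invf_lt1 // (lt_trans _ eta1).
have [ur hur] : exists ur : R, `|u| = (ur%:C)%C by exists (complex.Re `|u|); apply: complex_ge0_real.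
have ur0 : 0 <= ur by rewrite -lecR -hur; exact: normr_ge0.
have ur1 : ur < 1 by rewrite -ltcR -hur; exact: u1.
pose b := (map_poly ratr B).[eta].
pose a j := (map_poly ratr (A j)).[eta].
(* The quotients [a j / b] act as conjugates of the [T j]; this one reflects [T p.-1 = 1]. *)
have ab : a p.-1 = b.
  apply/eqP; rewrite -subr_eq0 -hornerN -hornerD -rmorphB; apply: trans.
  by rewrite rootE rmorphB hornerD hornerN -BA ?prednK // base_suffix_last // mulr1 subrr.
(* Dividing the equalities for two consecutive exponents gives [w = u]. *)
suff key M : w ^+ M < gamma -> ((w%:C)%C) ^+ M.+1 = u ^+ M.+1.
  have [M hM] := @expr_arb_small R w gamma (ltW w_gt0) w_lt1 g0.
  have e1 := key M hM; have e2 : ((w%:C)%C) ^+ M.+2 = u ^+ M.+2.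
    by apply: key; apply: le_lt_trans hM; rewrite exprS ler_piMl ?exprn_ge0 // ltW.
  have wu : (w%:C)%C = u.
    apply: (@mulIf _ (u ^+ M.+1)); first by rewrite expf_neq0 // invr_neq0.
    by rewrite -[RHS]exprS -e2 -e1 -exprS.
  by apply: invr_inj; rewrite -/u -wu /w fmorphV.
move=> hM; apply/eqP; rewrite -subr_eq0 -normr_eq0.
have nb : `|b| != 0 by rewrite normr_eq0.
rewrite -(mulrI_eq0 _ (mulfI nb)) -normrM; apply/eqP.
(* A common rate for the conjugated tails, which decay like [|u|], and for the distance from [q] to
   [w ^+ M.+1]. The three summands of [c] bound the three errors. *)
pose rho := Order.max ur w.
have rho0 : 0 <= rho by rewrite le_max ur0.
have rho1 : rho < 1 by rewrite gt_max ur1.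
pose c := `|b| + (\sum_(j < p) `|a j|) * (D%:~R / (1 - `|u|)) + `|b|.
apply: (@complex_eq0_geometric R _ c rho) => // K.
have [|q [N [qw /andP[q0 q1] MN rel est]]] := cyl M K p.-1 hM; first by rewrite prednK.
have vE : (base_prod bs (M * p + p.-1.+1))^-1 = w ^+ M.+1.
  by rewrite prednK // addnC -mulSn -[(M.+1 * p)%N]addn0 base_prod_period /base_prod
    [X in _ * X]big_ord0 mulr1 exprVn.
rewrite vE in qw.
pose s j := \sum_(0 <= k < N) (ab_digit bs (ratr q : R) (k * p + j))%:~R * u ^+ k.+1.
have relC : b * ratr q * (1 - u ^+ N) = \sum_(j < p) a j * s j.
  (* The periodicity relation multiplied by [B], with each [B T_j] replaced by [A j]: a rational
     polynomial vanishing at [delta], hence at [eta]. *)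
  pose G := B * (q%:P * ('X^N - 1)) - \sum_(j < p) A j * map_poly intr (S q N j).
  have : root (map_poly ratr G) eta.
    apply: trans; rewrite rootE rmorphB rmorphM rmorphM rmorphB rmorph_sum /=.
    rewrite map_polyC map_polyXn rmorph1 !(hornerD, hornerN, hornerM, hornerC, hornerXn).
    rewrite horner_sum rel mulr_sumr subr_eq0.
    apply/eqP; apply: eq_bigr => j _; rewrite rmorphM /= hornerM map_poly_ratr_int.
    by rewrite mulrA BA.
  rewrite rootE rmorphB rmorphM rmorphM rmorphB rmorph_sum /=.
  rewrite map_polyC map_polyXn rmorph1 !(hornerD, hornerN, hornerM, hornerC, hornerXn).
  rewrite horner_sum subr_eq0 => /eqP e.
  apply: (mulfI (expf_neq0 N eta0)); rewrite mulr_sumr.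
  have -> : eta ^+ N * (b * ratr q * (1 - u ^+ N)) = b * (ratr q * (eta ^+ N - 1)).
    have : eta ^+ N * u ^+ N = 1 by rewrite -exprMn divff // expr1n.
    by set x := eta ^+ N; set y := u ^+ N => h; ring: h.
  rewrite e; apply: eq_bigr => j _.
  by rewrite rmorphM /= hornerM map_poly_ratr_int horner_digit_polyV // mulrCA.
pose E j := s j - (j == p.-1)%:R * u ^+ M.+1.
have split_b : b * (ratr q - u ^+ M.+1) = b * ratr q * u ^+ N + \sum_(j < p) a j * E j.
  have -> : \sum_(j < p) a j * E j = \sum_(j < p) a j * s j - b * u ^+ M.+1.
    under eq_bigr => j _ do rewrite /E mulrBr.
    rewrite sumrB; congr (_ - _).
    have pp1 : (p.-1 < p)%N by rewrite prednK.
    rewrite (bigD1 (Ordinal pp1)) //= eqxx mul1r ab big1 ?addr0 // => j jp1.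
    case: eqP => [e|_]; last by rewrite mul0r mulr0.
    by case/eqP: jp1; apply: val_inj.
  by rewrite -relC !(mulrBr, mulr1) addrA subrKC.
have -> : b * ((w%:C)%C ^+ M.+1 - u ^+ M.+1) =
   b * ratr q * u ^+ N + \sum_(j < p) a j * E j - b * (ratr q - (w%:C)%C ^+ M.+1).
  by rewrite -split_b; ring.
have rq : (ratr q : R[i]) = ((ratr q : R)%:C)%C by rewrite fmorph_rat.
have ule n : (K <= n)%N -> `|u| ^+ n <= (rho%:C)%C ^+ K.
  move=> Kn; rewrite hur -!rmorphXn lecR; apply: le_trans (_ : ur ^+ K <= _).
    by rewrite ler_wiXn2l // ltW.
  by apply: lerXn2r; rewrite ?nnegrE // le_max lexx.
apply: (le_trans (ler_normB _ _)); rewrite /c !mulrDl; apply: lerD; last first.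
  rewrite normrM ler_wpM2l // rq -rmorphXn -rmorphB normc_def /= expr0n addr0 sqrtr_sqr /=.
  rewrite -rmorphXn lecR; apply: (le_trans qw).
  apply: le_trans (_ : w ^+ K <= _).
    by rewrite ler_wiXn2l ?(ltW w_gt0) ?(ltW w_lt1) // leqW // leq_addl.
  by apply: lerXn2r; rewrite ?nnegrE ?(ltW w_gt0) // le_max lexx orbT.
apply: (le_trans (ler_normD _ _)); apply: lerD.
  rewrite normrM [`|b * _|]normrM -mulrA ler_wpM2l // normrX -[leRHS]mul1r.
  apply: ler_pM; rewrite ?exprn_ge0 //.
    have qC0 : 0 <= (ratr q : R[i]) by rewrite rq -[0]/((0 : R)%:C)%C lecR.
    by rewrite (ger0_norm qC0) rq -[1]/((1 : R)%:C)%C lecR.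
  by apply: ule; apply: ltnW; apply: leq_ltn_trans MN; apply: leq_addl.
apply: (le_trans (ler_norm_sum _ _ _)); rewrite !mulr_suml; apply: ler_sum => j _.
rewrite normrM -mulrA ler_wpM2l //; apply: (le_trans (est _ u j u1 (ltn_ord j))).
have D1 : 0 <= (D%:~R : R[i]) / (1 - `|u|) by rewrite divr_ge0 ?ler0z ?subr_ge0 ?(ltW u1).
by rewrite ler_wpM2l //; apply: ule; rewrite leqW // leq_addl.
Qed.

End PurelyPeriodic.

(** * Algebraicity and integrality of [delta], its conjugates and its embeddings *)

Lemma exists_nat_not_root (F : numFieldType) (g : {poly F}) (n : nat) :
  g != 0 -> exists2 k, (n <= k)%N & ~~ root g k%:R.
Proof.
move=> g0; have : ~~ all (root g) [seq (k%:R : F) | k <- iota n (size g)].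
  apply/negP => /(max_poly_roots g0).
  rewrite map_inj_uniq ?iota_uniq ?size_map ?size_iota ?ltnn; first by move/(_ isT).
  by move=> i j /eqP; rewrite eqr_nat => /eqP.
case/allPn => x /mapP [k]; rewrite mem_iota => /andP[nk _] -> h.
by exists k.
Qed.

Lemma dvdp_root (F : numFieldType) (P g : {poly rat}) (z : F) :
  P %| g -> root (map_poly ratr P) z -> root (map_poly ratr g) z.
Proof. by move=> /dvdpP [r ->] h; rewrite rmorphM rootM h orbT. Qed.

Section Consequences.
Variables (R : realType) (bs : seq R).
Hypotheses (hb : alt_base bs) (pp : property_PP bs).
Local Notation p := (size bs).
Local Notation T := (base_suffix bs).
Local Notation delta := (\prod_(b <- bs) b).

Let d_gt1 : 1 < delta. Proof. exact: delta_gt1. Qed.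
Let d_gt0 : 0 < delta. Proof. exact: lt_trans d_gt1. Qed.
Let d_neq0 : delta != 0. Proof. exact: lt0r_neq0. Qed.

Lemma base_suffix_in_Qadj j : (j < p)%N -> in_Qadj delta (T j).
Proof.
have [B B0 [A BA]] := suffix_in_field hb pp.
move=> hj; exists (A j), B; split=> //.
by rewrite -BA // [_ * T j]mulrC mulfK.
Qed.

Lemma base_in_Qadj i : (i < p)%N -> in_Qadj delta (nth 0 bs i).
Proof.
case: i => [|i] hi.
  have -> : nth 0 bs 0 = delta / T 0 by rewrite [X in X / _](delta_suffix hb) mulfK // base_suffix_neq0.
  by apply: in_QadjM (in_Qadj_gen _) (in_QadjV _); apply: base_suffix_in_Qadj.
have -> : nth 0 bs i.+1 = T i / T i.+1 by rewrite base_suffix_rec // mulfK // base_suffix_neq0.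
by apply: in_QadjM (in_QadjV _); apply: base_suffix_in_Qadj => //; apply: ltnW.
Qed.

Lemma delta_algebraic : exists2 g : {poly rat}, g != 0 & root (map_poly ratr g) delta.
Proof.
have [B B0 [A BA]] := suffix_in_field hb pp.
apply: contrapT => trd.
have hg (g : {poly rat}) : root (map_poly ratr g) delta -> g = 0.
  by move=> gd; apply/eqP; apply: contrapT => /negP g0; apply: trd; exists g.
have BC0 : map_poly (ratr : rat -> R[i]) B != 0.
  by rewrite map_poly_eq0; apply: contraNneq B0 => ->; rewrite map_poly0 horner0.
(* Starting at this bound ensures both [k > 1] and [k > delta]. *)
have [k hk kB] := exists_nat_not_root (Num.bound delta).+2 BC0.
have := @conjugate_outside_disk R bs hb pp B A k%:R BA _ kB _.
rewrite normr_nat ltr1n => h.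
have /eqP : (k%:R : R[i]) = (delta%:C)%C.
  apply: h; last by apply: leq_trans hk.
  by move=> g /hg ->; rewrite map_poly0 root0.
rewrite -(rmorph_nat (real_complex R)) => /eqP /complexI e.
have := archi_boundP (ltW d_gt0); rewrite -[X in X < _]e ltr_nat; lia.
Qed.

(** The relation for [x = 1/b], which lies below [gamma] once [b] is large. Integrality uses the
    denominator [b]; the positivity argument uses the sign of the digits. *)
Lemma small_inverse_relation : exists b0, forall b, (b0 < b)%N -> exists2 N, (0 < N)%N &
  exists2 a : nat -> int, (forall k, 0 <= a k) & b%:R^-1 * (delta ^+ N - 1) =
    \sum_(j < p) T j * (map_poly intr (digit_poly a p N j)).[delta].
Proof.
have [gamma g0 rel] := PP_relation hb pp.
exists (Num.bound gamma^-1) => b hb0.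
have qE : ratr (b%:R^-1) = b%:R^-1 :> R by rewrite fmorphV /= ratr_nat.
have b_gt0 : 0 < b%:R :> R by rewrite ltr0n; apply: leq_ltn_trans hb0.
have [||q1 /(_ 0%N) [N N0 e]] := rel (b%:R^-1); rewrite ?qE ?invr_ge0 ?ltW //.
  rewrite -[ltRHS]invrK ltf_pV2 ?posrE ?invr_gt0 //.
  by apply: lt_trans (archi_boundP _) _; rewrite ?invr_ge0 ?ltW // ltr_nat.
exists N => //; exists (ab_digit bs (ratr b%:R^-1)); last by rewrite -e qE.
move=> k; rewrite -(ler0z R); case: (@ab_digit_itv R bs hb (ratr b%:R^-1) k) => //.
by rewrite q1 qE invr_ge0 ltW.
Qed.

Lemma delta_inv_integer : algebraic_integer delta^-1.
Proof.
have [g g0 gd] := delta_algebraic; have [b0 rel] := small_inverse_relation.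
apply: (@inv_algebraic_integer R delta g T p b0) => //; first exact: base_suffix_in_Qadj.
by move=> b /rel [N N0 [a _ e]]; exists N, (digit_poly a p N).
Qed.

Lemma delta_integer : algebraic_integer delta.
Proof.
have [P [Pm Pd]] := delta_inv_integer; have [b0 rel] := small_inverse_relation.
rewrite -[delta]invrK.
apply: (@inv_algebraic_integer R delta^-1 (map_poly intr P) T p b0).
- by rewrite invr_eq0.
- by apply: monic_neq0; apply: monic_map.
- by rewrite map_poly_ratr_int.
- move=> j /base_suffix_in_Qadj; apply: in_Qadj_trans.
  by rewrite -{2}[delta]invrK; apply: in_QadjV; apply: in_Qadj_gen.
move=> b /rel [N N0 [a _ e]].
(* Multiplying the relation by [- delta ^- N] turns it into one in [z = 1/delta], where
   [z ^+ N * S_j(1/z)] has the powers [k.+1]. *)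
exists N, (fun j => - \sum_(k < N) (a (k * p + j)%N)%:P * 'X^(k.+1)) => //.
have dN : delta ^+ N != 0 by rewrite expf_neq0.
apply: (mulfI dN); transitivity (- (b%:R^-1 * (delta ^+ N - 1))).
  by rewrite exprVn mulrCA mulrBr divff // mulr1 -mulrN opprB.
rewrite e -sumrN mulr_sumr; apply: eq_bigr => j _.
rewrite horner_digit_polyV // rmorphN hornerN rmorph_sum horner_sum big_mkord mulrCA -mulrN -mulrN.
congr (_ * (_ * - _)); apply: eq_bigr => k _.
by rewrite rmorphM /= map_polyC map_polyXn hornerM hornerC hornerXn.
Qed.

Lemma conjugate_norm_le1 (z : R[i]) :
  conjugate_of delta z -> z != (delta%:C)%C -> `|z| <= 1.
Proof.
have [B B0 [A BA]] := suffix_in_field hb pp.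
move=> [P [_ [irrP [Pd Pz]]]]; rewrite real_leNgt ?normr_real ?real1 //; apply: contraNN => z1.
apply/eqP; apply: (conjugate_outside_disk hb pp BA _ _ z1).
  by move=> g gd; apply: dvdp_root Pz; apply: root_irreducible_dvdp Pd gd.
(* If [B] vanished at [z], the minimal polynomial [P] would divide it and [B] would vanish at
   [delta]. *)
apply: contraNN B0 => Bz; rewrite -rootE.
by apply: dvdp_root Pd; apply: root_irreducible_dvdp Pz Bz.
Qed.

(** The image of the relation for [1/b] has a nonnegative right-hand side, whereas
    [0 < psi delta < 1] would make the left-hand side negative. The value 1 is excluded because
    [delta - 1] is not sent to 0. *)
Lemma positive_embedding_gt1 (psi : R -> R[i]) : field_embedding delta psi ->
  (forall i, (i < p)%N -> positive_real (psi (nth 0 bs i))) -> 1 < psi delta.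
Proof.
move=> emb pos.
have {}pos i : 0 < psi (base_at bs i).
  have [im re] := pos (i %% p)%N (ltn_pmod _ (proj1 hb)).
  by rewrite ltcE /= im eqxx.
have bin i : in_Qadj delta (base_at bs i) by apply: base_in_Qadj; rewrite ltn_pmod ?(proj1 hb).
have Tpos j : 0 < psi (T j).
  by rewrite (embedding_prod emb) // prodr_gt0.
have din := in_Qadj_gen delta.
have eta0 : 0 < psi delta.
  by rewrite -(base_prod_size bs) /base_prod (embedding_prod emb) // prodr_gt0.
have eta_neq1 : psi delta != 1.
  have in1 : in_Qadj delta (-1) by rewrite -(rmorphN1 ratr); apply: in_Qadj_ratr.
  have := @embedding_neq0 _ _ _ emb (delta + -1) (in_QadjD din in1).
  have psiN1 : psi (-1) = -1 := embedding_int emb (-1).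
  case: (emb) => h1 [hD _]; rewrite hD // psiN1 !subr_eq0 gt_eqF //; exact.
have eta_real : psi delta \is Num.real by rewrite gtr0_real.
rewrite real_ltNge ?real1 //; apply/negP => eta1.
have eta_lt1 : psi delta < 1 by rewrite lt_neqAle eta_neq1.
have [b0 /(_ b0.+1 (ltnSn _)) [N N0 [a a0 e]]] := small_inverse_relation.
have [_ [_ hM]] := emb.
pose S j : {poly rat} := map_poly intr (digit_poly a p N j).
have := congr1 psi e; have -> : b0.+1%:R^-1 * (delta ^+ N - 1) =
    (map_poly ratr ((b0.+1%:R^-1)%:P * ('X^N - 1))).[delta].
  rewrite rmorphM rmorphB /= map_polyC map_polyXn rmorph1.
  by rewrite !(hornerD, hornerN, hornerM, hornerC, hornerXn) /= fmorphV /= ratr_nat.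
have -> : \sum_(j < p) T j * (map_poly intr (digit_poly a p N j)).[delta] =
    \sum_(j < p) T j * (map_poly ratr (S j)).[delta].
  by apply: eq_bigr => j _; rewrite map_poly_ratr_int.
have Tin (j : 'I_p) : in_Qadj delta (T j) by apply: base_suffix_in_Qadj.
have Sin j : in_Qadj delta (map_poly ratr (S j)).[delta] by apply: in_Qadj_horner.
rewrite (embedding_horner emb) (embedding_sum emb); last by move=> j _; apply: in_QadjM.
rewrite rmorphM rmorphB /= map_polyC map_polyXn rmorph1.
rewrite !(hornerD, hornerN, hornerM, hornerC, hornerXn) /= fmorphV /= ratr_nat => eC.
have : 0 <= b0.+1%:R^-1 * (psi delta ^+ N - 1).
  rewrite eC; apply: sumr_ge0 => j _; rewrite hM // mulr_ge0 ?(ltW (Tpos j)) //.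
  rewrite (embedding_horner emb) map_poly_ratr_int horner_digit_poly; apply: sumr_ge0 => k _.
  by rewrite mulr_ge0 ?ler0z // exprn_ge0 // ltW.
rewrite pmulr_rge0 ?invr_gt0 ?ltr0n // subr_ge0 => h.
have hN : psi delta ^+ N < 1 by rewrite exprn_ilt1 ?(ltW eta0) // -lt0n.
by have := lt_le_trans hN h; rewrite ltxx.
Qed.

(** Lying outside the closed unit disk, [psi delta] equals [delta], and then [psi] fixes every
    quotient of polynomials in [delta]. *)
Lemma not_positive_embedding (psi : R -> R[i]) : field_embedding delta psi ->
  non_identical delta psi -> ~ (forall i, (i < p)%N -> positive_real (psi (nth 0 bs i))).
Proof.
move=> emb [x [[A' [B' [B'0 xE]]] nid]] pos.
have eta1 := positive_embedding_gt1 emb pos.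
have eta0 := lt_trans ltr01 eta1.
have [B B0 [A BA]] := suffix_in_field hb pp.
have eta : psi delta = (delta%:C)%C.
  apply: (conjugate_outside_disk hb pp BA).
  - by move=> g; rewrite !rootE -(embedding_horner emb) => /eqP ->; rewrite (embedding0 emb).
  - by rewrite -(embedding_horner emb) (embedding_neq0 emb) //; apply: in_Qadj_horner.
  - by rewrite gtr0_norm.
move: nid; rewrite xE; case: (emb) => _ [_ hM].
have hA' := in_Qadj_horner delta A'; have hB' := in_Qadj_horner delta B'.
rewrite hM ?(embeddingV emb) //; last exact: in_QadjV.
by rewrite !(embedding_horner emb) eta !horner_ratr_complex rmorphM fmorphV eqxx.
Qed.

End Consequences.

Theorem theoremB (R : realType) (bs : seq R) :
  alt_base bs -> property_PP bs ->
  let delta := \prod_(b <- bs) b in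
  (pisot_unit delta \/ salem_unit delta) /\
  (forall i, (i < size bs)%N -> in_Qadj delta (nth 0 bs i)) /\
  (forall psi : R -> R[i],
     field_embedding delta psi -> non_identical delta psi ->
     ~ (forall i, (i < size bs)%N -> positive_real (psi (nth 0 bs i)))).
Proof.
move=> hb pp delta; split; last split.
- have d1 : 1 < delta := delta_gt1 hb.
  have int := delta_integer hb pp; have unit : algebraic_unit delta.
    by split; [exact: int | exact: delta_inv_integer].
  have conj z := @conjugate_norm_le1 R bs hb pp z.
  (* All other conjugates have modulus at most 1; one of modulus exactly 1 separates Salem from
     Pisot. *)
  case: (pselect (exists z : R[i], conjugate_of delta z /\ z != (delta%:C)%C /\ `|z| = 1)) => h.
    by right; split.
  left; split=> //; do 2!split=> //; move=> z hz nz; rewrite lt_neqAle conj // andbT.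
  by apply/eqP => z1; apply: h; exists z.
- exact: base_in_Qadj.
- exact: not_positive_embedding.
Qed.
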